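(* Let $p$ be a prime, $f(x)\in\overline{\mathbb{F}_p}[x]$ of degree $d$ with $\gcd(d,p)=1$, and let $\lambda,\mu\in\overline{\mathbb{F}_p}^\times$ satisfy $\lambda^{p-1}=\mu^{p-1}$. Let $q=p^a$ be such that $f\in\mathbb{F}_q[x]$ and $\lambda,\mu\in\mathbb{F}_q$. Then, with Newton polygons computed over $\mathbb{F}_q$, \[ \mathrm{NP}(\lambda f)=\mathrm{NP}(\mu f). \]
   Context: Let $\mathbb{Q}_q$ be the unramified extension of $\mathbb{Q}_p$ of degree $a$, with ring of integers $\mathbb{Z}_q$, and fix a primitive $p$-th root of unity $\zeta_p\in\mathbb{C}_p$. For $g(x)\in\mathbb{F}_q[x]$ with $\gcd(\deg g,p)=1$, let $\hat g(x)\in\mathbb{Z}_q[x]$ be obtained by replacing each coefficient by its Teichmüller lift, and for $k\ge1$ set $S_g^*(k)=\sum_{x}\zeta_p^{\mathrm{Tr}_{\mathbb{Q}_{q^k}/\mathbb{Q}_p}(\hat g(x))}$, the sum over the Teichmüller lifts $x\in\mathbb{Z}_{q^k}^\times$ of the elements of $\mathbb{F}_{q^k}^\times$. Let $L_g^*(s)=\exp\big(\sum_{k\ge1}S_g^*(k)s^k/k\big)=\sum_{n=0}^{\deg g}c_ns^n$ (a polynomial of degree $\deg g$). The Newton polygon $\mathrm{NP}(g)$ is the lower convex hull of the points $(n,\mathrm{ord}_p c_n)$, with $\mathrm{ord}_p(p)=1$. *)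

(* Defs.v *)
From HB Require Import structures.
From mathcomp Require Import all_boot all_order all_algebra.
From mathcomp Require Import all_classical all_reals all_analysis.

Set Implicit Arguments.
Unset Strict Implicit.
Unset Printing Implicit Defensive.

Import Order.TTheory GRing.Theory Num.Theory.
Local Open Scope classical_set_scope.
Local Open Scope ring_scope.

Section FieldExtensions.
Variables (K : fieldType) (F E : set K).

Definition is_basis (n : nat) (e : 'I_n -> K) : Prop :=
  [/\ forall i, E (e i),
      forall c : 'I_n -> K, (forall i, F (c i)) ->
        \sum_i c i * e i = 0 -> forall i, c i = 0
    & forall x, E x -> exists2 c : 'I_n -> K,
        (forall i, F (c i)) & x = \sum_i c i * e i].

(* Tr_{E/F}(x) is the trace of the F-linear map y |-> x * y on E; the value is
   0 when E is not a finite extension of F or x is not in E. *)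
Definition field_trace (x : K) : K :=
  xget 0 [set t | exists n (e : 'I_n -> K) (A : 'M[K]_n),
    [/\ is_basis e,
        forall i j, F (A i j),
        forall i, x * e i = \sum_j A i j * e j
      & t = \tr A]].

End FieldExtensions.

Section Valued.
Variables (R : realType) (K : closedFieldType) (ord : K -> \bar R).

Definition ord_cauchy (u : nat -> K) : Prop :=
  forall M : R, exists N : nat, forall m n : nat,
    (N <= m)%N -> (N <= n)%N -> (M%:E <= ord (u m - u n))%E.

Definition ord_converges (u : nat -> K) (l : K) : Prop :=
  forall M : R, exists N : nat, forall n : nat,
    (N <= n)%N -> (M%:E <= ord (u n - l))%E.

(* Q_p inside C_p, as the closure of the prime field Q. *)
Definition Qp : set K :=
  [set x | forall M : R, exists r : rat, (M%:E <= ord (x - ratr r))%E].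

Definition algebraic_over_Qp (y : K) : Prop :=
  exists P : {poly K}, [/\ P != 0, forall i, Qp P`_i & root P y].

(* (K, ord) is C_p with ord_p normalised by ord_p(p) = 1: K is algebraically
   closed (by its type), complete, and the algebraic closure of Q_p in K is
   dense. This determines (K, ord) up to isomorphism; characteristic 0 and
   the fact that ord extends the p-adic valuation of Q are consequences. *)
Record is_Cp (p : nat) : Prop := IsCp {
  Cp_ord_neq_ninfty : forall x, ord x != -oo%E;
  Cp_ord_eq_infty : forall x, ord x = +oo%E <-> x = 0;
  Cp_ordM : forall x y, ord (x * y) = (ord x + ord y)%E;
  Cp_ordD : forall x y, (Order.min (ord x) (ord y) <= ord (x + y))%E;
  Cp_ord_p : ord p%:R = 1%E;
  Cp_complete : forall u, ord_cauchy u -> exists l, ord_converges u l;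
  Cp_dense : forall x (M : R),
    exists2 y, algebraic_over_Qp y & (M%:E <= ord (x - y))%E
}.

(* Unramified of degree n over Q_p means ramification index 1, i.e. same value
   group as Q_p; separability of the residue extension is automatic because
   F_p is perfect. *)
Definition is_unramified_ext (n : nat) (E : set K) : Prop :=
  [/\ divring_closed (mem E),
      Qp `<=` E,
      exists e : 'I_n -> K, is_basis Qp E e
    & forall x, E x -> x != 0 ->
        exists y, [/\ Qp y, y != 0 & ord x = ord y]].

(* red is reduction modulo the maximal ideal, O_{C_p} -> residue field k;
   its values outside O_{C_p} are irrelevant. *)
Record is_reduction (k : fieldType) (red : K -> k) : Prop := IsReduction {
  red1 : red 1 = 1;
  redD : forall x y, (0 <= ord x)%E -> (0 <= ord y)%E ->
    red (x + y) = red x + red y;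
  redM : forall x y, (0 <= ord x)%E -> (0 <= ord y)%E ->
    red (x * y) = red x * red y;
  red_eq0 : forall x, (0 <= ord x)%E -> (red x = 0 <-> (0 < ord x)%E);
  red_surj : forall u, exists2 x, (0 <= ord x)%E & red x = u
}.

(* zeta ^ z for a p-th root of unity zeta and z in Z_p: this is zeta ^ m for
   any natural number m congruent to z modulo p Z_p. *)
Definition zeta_pow (zeta z : K) : K :=
  xget 1 [set w | exists2 m : nat, (1 <= ord (z - m%:R))%E & w = zeta ^+ m].

End Valued.

(* F_{p^n} inside an algebraic closure k of F_p. *)
Definition Fq (k : fieldType) (p n : nat) : {pred k} :=
  [pred u | u ^+ (p ^ n) == u].
Arguments Fq : clear implicits.

Section FormalExp.
Variable K : fieldType.

(* Coefficient of s^n in exp(sum_(k >= 1) u_k s^k); truncating the exponential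
   and the inner series at order n does not change this coefficient. *)
Definition exp_coef (u : nat -> K) (n : nat) : K :=
  (\sum_(j < n.+1)
     (j`!%:R)^-1 *: (\sum_(1 <= k < n.+1) u k *: 'X^k) ^+ j : {poly K})`_n.

End FormalExp.

Section LowerHull.
Variable R : realType.

Definition lower_convex_hull (P : set (R^o * R^o)) : set (R^o * R^o) :=
  let H := smallest (@convex_set R (R^o * R^o)%type) P in
  [set x | H x /\ forall y, H (x.1, y) -> x.2 <= y].

End LowerHull.

Section Lfunction.
Variables (R : realType) (p : nat).
Variables (K : closedFieldType) (ord : K -> \bar R).
Variables (k : fieldType) (red : K -> k).
(* Q n is the unramified extension of Q_p of degree n. *)
Variable Q : nat -> set K.
Variable zeta : K.

(* Teichmuller lift to Z_{p^n} of an element u of F_{p^n}. *)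
Definition teichmuller (n : nat) (u : k) : K :=
  xget 0 [set t | [/\ Q n t, (0 <= ord t)%E, red t = u & t ^+ (p ^ n) = t]].

Definition teichmuller_poly (n : nat) (g : {poly k}) : {poly K} :=
  map_poly (teichmuller n) g.

(* In what follows q = p ^ a, so that q ^ m = p ^ (a * m). *)
Definition exp_sum (a : nat) (g : {poly k}) (m : nat) : K :=
  \sum_(u \in [set u : k | u != 0 /\ u \in Fq k p (a * m)])
    zeta_pow ord zeta
      (field_trace (Qp ord) (Q (a * m))
         (teichmuller_poly a g).[teichmuller (a * m) u]).

Definition Lstar_coef (a : nat) (g : {poly k}) (n : nat) : K :=
  exp_coef (fun m => exp_sum a g m / m%:R) n.

(* Indices n with c_n = 0 have ord c_n = +oo and contribute no point. *)
Definition newton_polygon (a : nat) (g : {poly k}) : set (R^o * R^o) :=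
  lower_convex_hull
    [set x | exists n : nat,
       [/\ (n <= (size g).-1)%N, x.1 = n%:R & ord (Lstar_coef a g n) = x.2%:E]].

End Lfunction.

(* Main.v *)
Require Import Defs.
From HB Require Import structures.
From mathcomp Require Import all_boot all_order all_algebra.
From mathcomp Require Import all_classical all_reals all_analysis.
From mathcomp Require Import ring lra zify.

Import Order.TTheory GRing.Theory Num.Theory.
Local Open Scope classical_set_scope.
Local Open Scope ring_scope.

(** Since [lambda / mu] is fixed by Frobenius, it is the class of an integer [c]
prime to [p].  The Teichmuller representative [w] of [c] lies in Z_p, so
multiplying a polynomial by [c] multiplies its Teichmuller lift, hence all the
traces in the exponential sums, by [w]; the effect is to replace [zeta] by
[zeta ^+ c].  Each coefficient of the L-function is a rational polynomial
expression in [zeta], so it remains to see that [ord P(zeta) = ord P(zeta ^+ c)]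
for [P] in Z[X].  Reducing [P] modulo the p-th cyclotomic polynomial and
expanding it in powers of [X - 1] gives [P(zeta) = \sum_(i < p - 1) t_i (zeta - 1) ^ i]
with [ord (zeta - 1) = 1 / (p - 1)]; the terms have distinct valuations, so
[ord P(zeta)] is the minimum of [ord t_i + i / (p - 1)], which does not depend
on the choice of the primitive root [zeta]. *)

Section Valuation.
Set Implicit Arguments.
Unset Strict Implicit.
Variables (R : realType) (p : nat) (p_prime : prime p).
Variables (K : closedFieldType) (ord : K -> \bar R) (CpP : is_Cp ord p).

(** * Valuations of sums, products and integers *)

Lemma ord_zero : ord 0 = +oo%E.
Proof. exact/(Cp_ord_eq_infty CpP). Qed.

Lemma ord_fin x : x != 0 -> exists v : R, ord x = v%:E.
Proof.
move=> x0; case E: (ord x) => [v| |]; first by exists v.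
  by move/(Cp_ord_eq_infty CpP): E x0 => ->; rewrite eqxx.
by have := Cp_ord_neq_ninfty CpP x; rewrite E.
Qed.

Lemma ord_lbound x : exists B : R, (B%:E <= ord x)%E.
Proof.
have [->|/ord_fin [v ->]] := eqVneq x 0; last by exists v.
by exists 0; rewrite ord_zero leey.
Qed.

Lemma ord_one : ord 1 = 0%E.
Proof.
have [v E] := ord_fin (oner_neq0 K).
have := Cp_ordM CpP 1 1; rewrite mulr1 E -EFinD => -[?].
by congr (_%:E); lra.
Qed.

Lemma ordM_fin x y v w : ord x = v%:E -> ord y = w%:E -> ord (x * y) = (v + w)%:E.
Proof. by move=> vx wy; rewrite (Cp_ordM CpP) vx wy. Qed.

Lemma ordX_fin x v n : ord x = v%:E -> ord (x ^+ n) = (v *+ n)%:E.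
Proof.
move=> vx; elim: n => [|n IHn]; first by rewrite expr0 ord_one.
by rewrite exprS mulrS; apply: ordM_fin.
Qed.

Lemma ordN x : ord (- x) = ord x.
Proof.
have N1 : ord (-1) = 0%E.
  have n0 : (-1 : K) != 0 by rewrite oppr_eq0 oner_neq0.
  have [v E] := ord_fin n0.
  have := ordM_fin E E; rewrite mulrNN mulr1 ord_one E => -[?].
  by congr (_%:E); lra.
by rewrite -mulN1r (Cp_ordM CpP) N1 add0e.
Qed.

Lemma ordB x y : ord (x - y) = ord (y - x).
Proof. by rewrite -opprB ordN. Qed.

Lemma ordD_ge M x y : (M <= ord x -> M <= ord y -> M <= ord (x + y))%E.
Proof. by move=> Mx My; apply: le_trans (Cp_ordD CpP x y); rewrite le_min Mx. Qed.

Lemma ordD_gt M x y : (M < ord x -> M < ord y -> M < ord (x + y))%E.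
Proof. by move=> Mx My; apply: lt_le_trans (Cp_ordD CpP x y); rewrite lt_min Mx. Qed.

Lemma ord_dist_ge M x y z : (M <= ord (x - y) -> M <= ord (y - z) -> M <= ord (x - z))%E.
Proof.
by move=> Mxy Myz; rewrite -(subrK y x) -addrA; apply: ordD_ge.
Qed.

Lemma ord_sum_ge (I : Type) (r : seq I) (P : pred I) (F : I -> K) M :
  (forall i, P i -> M <= ord (F i))%E -> (M <= ord (\sum_(i <- r | P i) F i))%E.
Proof.
move=> MF; apply: (big_ind (fun x => M <= ord x)%E) => //; last exact: ordD_ge.
by rewrite ord_zero leey.
Qed.

Lemma ordM_ge M x y : (0 <= ord x -> M <= ord y -> M <= ord (x * y))%E.
Proof.
by move=> x0 My; rewrite (Cp_ordM CpP) -[M]add0e; apply: leeD.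
Qed.

Lemma ordX_ge0 x n : (0 <= ord x -> 0 <= ord (x ^+ n))%E.
Proof.
move=> x0; elim: n => [|n IHn]; first by rewrite expr0 ord_one.
by rewrite exprS; apply: ordM_ge.
Qed.

Lemma ord_nat_ge0 n : (0 <= ord n%:R)%E.
Proof.
elim: n => [|n IHn]; first by rewrite ord_zero leey.
by rewrite mulrS; apply: ordD_ge; rewrite ?ord_one.
Qed.

Lemma ord_int_ge0 (m : int) : (0 <= ord m%:~R)%E.
Proof. by case: m => n; rewrite ?NegzE ?mulrNz ?ordN; apply: ord_nat_ge0. Qed.

Lemma coprime_p_gt0 n : coprime p n -> (0 < n)%N.
Proof. by case: n => //; rewrite /coprime gcdn0 => /eqP p1; move: p_prime; rewrite p1. Qed.

(** If [ord n] were positive, a Bezout relation would write 1 as a combination of [n] and [p] with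
    integer coefficients, forcing [ord 1] to be positive. *)
Lemma ord_coprime n : coprime p n -> ord n%:R = 0%E.
Proof.
move=> cpn; apply/eqP; rewrite eq_le ord_nat_ge0 andbT leNgt; apply/negP => n_gt0.
have [u uE] : exists u, u * n = 1 %[mod p].
  have [u v uE _] := egcdnP p (coprime_p_gt0 cpn); exists u; rewrite uE.
  by move: cpn; rewrite coprime_sym => /eqP ->; rewrite modnMDl.
have : (0 < ord 1)%E; last by rewrite ord_one ltxx.
have -> : (1 : K) = (u * n)%:R - (u * n %/ p)%:R * p%:R.
  rewrite [X in X%:R](divn_eq _ p) uE modn_small ?prime_gt1 //.
  by rewrite natrD natrM addrC addKr.
apply: ordD_gt.
  rewrite natrM (Cp_ordM CpP).
  apply: (lt_le_trans n_gt0); rewrite leeDr ?ord_nat_ge0 //.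
rewrite ordN (Cp_ordM CpP) (Cp_ord_p CpP).
by apply: (@lt_le_trans _ _ 1%E); rewrite ?lte01 // leeDr ?ord_nat_ge0.
Qed.

Lemma ord_nat n : (0 < n)%N -> ord n%:R = ((logn p n)%:R)%:E.
Proof.
move=> n0; have [m cpm] := pfactor_coprime p_prime n0; set k := logn p n => ->.
rewrite natrM natrX (ordM_fin (ord_coprime cpm) (ordX_fin k (Cp_ord_p CpP))).
by rewrite add0r.
Qed.

Lemma natr_neq0 n : (0 < n)%N -> n%:R != 0 :> K.
Proof. by move=> /ord_nat E; apply/eqP=> n0; move: E; rewrite n0 ord_zero. Qed.

Lemma intr_neq0 (m : int) : m != 0 -> m%:~R != 0 :> K.
Proof.
case: m => n n0; first by apply: natr_neq0; rewrite lt0n.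
by rewrite NegzE mulrNz oppr_eq0; apply: natr_neq0.
Qed.

Lemma ord_int (m : int) : m != 0 -> ord m%:~R = ((logn p `|m|)%:R)%:E.
Proof.
case: m => n n0; first by rewrite ord_nat // lt0n.
by rewrite NegzE mulrNz ordN abszN ord_nat.
Qed.

Lemma ordD_neq x y : ord x != ord y -> ord (x + y) = Order.min (ord x) (ord y).
Proof.
wlog xy : x y / (ord x < ord y)%E => [H|_].
  rewrite neq_lt => /orP[xy|yx]; first by rewrite H ?lt_eqF.
  by rewrite addrC minC H ?lt_eqF.
rewrite (min_idPl (ltW xy)); apply/eqP; rewrite eq_le andbC.
rewrite ordD_ge ?(ltW xy) //= leNgt; apply/negP => xxy.
have : (ord x < ord (x + y - y))%E by apply: ordD_gt; rewrite ?ordN.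
by rewrite addrK ltxx.
Qed.

(** By induction, the valuation of the tail is [+oo] or that of one of its terms, hence differs from
    that of a nonzero head, and [ordD_neq] applies. Zero terms all share the valuation [+oo], so
    only nonzero ones are asked to be distinguished. *)
Lemma ord_sum_distinct (I : eqType) (r : seq I) (F : I -> K) : uniq r ->
  {in r &, forall i j, F i != 0 -> ord (F i) = ord (F j) -> i = j} ->
  ord (\sum_(i <- r) F i) = \big[Order.min/+oo%E]_(i <- r) ord (F i).
Proof.
elim: r => [|x r IHr] /=; first by rewrite !big_nil ord_zero.
case/andP=> xr ur dF; rewrite !big_cons.
have {}IHr : ord (\sum_(i <- r) F i) = \big[Order.min/+oo%E]_(i <- r) ord (F i).
  by apply: IHr => // i j ir jr; apply: dF; rewrite inE ?ir ?jr orbT.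
rewrite -IHr; have [Fx0|Fx0] := eqVneq (F x) 0.
  by rewrite Fx0 add0r ord_zero; rewrite (min_idPr _) ?leey.
apply: ordD_neq; rewrite IHr; apply/eqP => E.
have : \big[Order.min/+oo%E]_(i <- r) ord (F i) = +oo%E \/
    exists2 i, i \in r & \big[Order.min/+oo%E]_(i <- r) ord (F i) = ord (F i).
  elim: (r) => [|y s IHs]; first by rewrite big_nil; left.
  rewrite big_cons; case: leP => [_|_].
    by right; exists y; rewrite ?mem_head.
  by case: IHs => [->|[i si ->]]; [left|right; exists i; rewrite ?inE ?si ?orbT].
case=> [oo|[i ri Ei]].
  by move: Fx0; rewrite oo in E; move/(Cp_ord_eq_infty CpP): E => ->; rewrite eqxx.
have xi : x = i by apply: dF; rewrite ?mem_head ?inE ?ri ?orbT // E.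
by move: xr; rewrite xi ri.
Qed.

(** * Rational numbers in [K] and the ring structure of their closure *)

(** Characteristic 0 is known for [K] only through [ord], so the compatibility of [ratr] with sums
    and products is derived from the nonvanishing of integers in [K]. *)
Lemma ratr_frac (m n : int) : n != 0 ->
  ratr (m%:~R / n%:~R) = m%:~R / n%:~R :> K.
Proof.
move=> n0; set r : rat := _ / _.
have d0 : (denq r)%:~R != 0 :> K by rewrite intr_neq0 ?denq_neq0.
have n0K : n%:~R != 0 :> K by rewrite intr_neq0.
have n0Q : n%:~R != 0 :> rat by rewrite intr_eq0.
apply/eqP; rewrite /ratr eqr_div // -!intrM; apply/eqP; congr (_%:~R).
apply: (@intr_inj rat); rewrite !intrM numqE mulrAC; congr (_ * _).
by rewrite /r divfK.
Qed.

Lemma ratrD (r s : rat) : ratr (r + s) = ratr r + ratr s :> K.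
Proof.
have dr := intr_neq0 (denq_neq0 r); have ds := intr_neq0 (denq_neq0 s).
rewrite -{1}[r]divq_num_den -{1}[s]divq_num_den addf_div ?intr_eq0 ?denq_neq0 //.
by rewrite -!intrM -intrD ratr_frac ?mulf_neq0 ?denq_neq0 // intrD !intrM -addf_div.
Qed.

Lemma ratrM (r s : rat) : ratr (r * s) = ratr r * ratr s :> K.
Proof.
rewrite -{1}[r]divq_num_den -{1}[s]divq_num_den mulf_div.
by rewrite -!intrM ratr_frac ?mulf_neq0 ?denq_neq0 // !intrM -mulf_div.
Qed.

Lemma QpD x y : Qp ord x -> Qp ord y -> Qp ord (x + y).
Proof.
move=> Qx Qy M; have [r xr] := Qx M; have [s ys] := Qy M.
by exists (r + s); rewrite ratrD opprD addrACA; apply: ordD_ge.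
Qed.

Lemma QpM x y : Qp ord x -> Qp ord y -> Qp ord (x * y).
Proof.
move=> Qx Qy M; have [A xA] := ord_lbound x; have [B yB] := ord_lbound y.
(* The bound [B] makes [ratr s] at least as integral as [y] is known to be; [M - A] compensates for
   the factor [x] in the first term of the decomposition below. *)
have [s] := Qy (Num.max B (M - A)).
rewrite EFin_max ge_max => /andP[ysB ysM].
have sB : (B%:E <= ord (ratr s))%E.
  by rewrite -[ratr s](subKr y) addrC; apply: ordD_ge => //; rewrite ordN.
have [r xr] := Qx (M - B).
exists (r * s).
have -> : x * y - ratr (r * s) = x * (y - ratr s) + (x - ratr r) * ratr s.
  by rewrite ratrM; ring.
apply: ordD_ge; rewrite (Cp_ordM CpP).
  by rewrite -[M](subrKC A) EFinD; apply: leeD.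
by rewrite -[M](subrK B) EFinD; apply: leeD.
Qed.

Lemma ord_eq_mod m n : m = n %[mod p] -> (1 <= ord (m%:R - n%:R))%E.
Proof.
move=> mn; have -> : m%:R - n%:R = ((m %/ p)%:Z - (n %/ p)%:Z)%:~R * p%:R :> K.
  rewrite {1}(divn_eq m p) {1}(divn_eq n p) mn !natrD !natrM intrB -!pmulrn.
  by rewrite mulrBl; ring.
by rewrite mulrC (Cp_ordM CpP) (Cp_ord_p CpP) leeDl ?ord_int_ge0.
Qed.

Lemma Qp_nat n : Qp ord n%:R.
Proof. by move=> M; exists n%:R; rewrite ratr_nat subrr ord_zero leey. Qed.

Lemma QpN x : Qp ord x -> Qp ord (- x).
Proof.
move=> Qx; rewrite -mulN1r; apply: QpM => // M; exists (-1%:~R).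
by rewrite -mulrNz ratr_int mulrNz subrr ord_zero leey.
Qed.

Lemma Qp_sum (I : Type) (r : seq I) (P : pred I) (F : I -> K) :
  (forall i, P i -> Qp ord (F i)) -> Qp ord (\sum_(i <- r | P i) F i).
Proof.
move=> QF; apply: (big_ind (Qp ord)) => //; [exact: (Qp_nat 0)|exact: QpD].
Qed.

(** * Congruences between powers, and Teichmuller representatives in Z_p *)

Lemma ord_subX M x y n : (0 <= ord x -> 0 <= ord y -> M <= ord (x - y) ->
  M <= ord (x ^+ n - y ^+ n))%E.
Proof.
move=> x0 y0 xy; rewrite subrXX mulrC; apply: ordM_ge => //.
by apply: ord_sum_ge => i _; apply: ordM_ge; apply: ordX_ge0.
Qed.

(** In x^p - y^p = (x - y) S, the cofactor S is congruent to p x^(p-1) modulo x - y, and both p and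
    x - y have valuation at least 1. *)
Lemma ord_subXp x y (k : R) : 1 <= k -> (0 <= ord x -> 0 <= ord y ->
  k%:E <= ord (x - y) -> (k + 1)%:E <= ord (x ^+ p - y ^+ p))%E.
Proof.
move=> k1 x0 y0 xy; rewrite subrXX (Cp_ordM CpP) EFinD; apply: leeD => //.
have xy1 : (1 <= ord (x - y))%E by apply: le_trans xy; rewrite lee_fin.
rewrite -[X in ord X](subrK (x ^+ p.-1 *+ p)); apply: ordD_ge; last first.
  rewrite -mulr_natr; apply: ordM_ge; first exact: ordX_ge0.
  by rewrite (Cp_ord_p CpP).
have -> : x ^+ p.-1 *+ p = \sum_(i < p) x ^+ p.-1 by rewrite sumr_const card_ord.
rewrite -sumrB; apply: ord_sum_ge => i _.
have -> : x ^+ p.-1 = x ^+ (p.-1 - i) * x ^+ i.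
  by rewrite -exprD subnK // -ltnS prednK ?prime_gt0.
rewrite -mulrBr; apply: ordM_ge; first exact: ordX_ge0.
by apply: ord_subX => //; rewrite ordB.
Qed.

(* The limit of the sequence c ^ (p ^ n). *)
Lemma Qp_teichmuller (c : nat) : exists w : K,
  [/\ Qp ord w, (0 <= ord w)%E, (1 <= ord (w - c%:R))%E & w ^+ p = w].
Proof.
pose u n : K := c%:R ^+ (p ^ n).
have u_ge0 n : (0 <= ord (u n))%E by apply/ordX_ge0/ord_nat_ge0.
have uX n : u n.+1 = u n ^+ p by rewrite /u expnSr exprM.
(* Fermat's little theorem starts the induction; each further p-th power gains one unit of
   valuation. *)
have uS n : ((n.+1%:R : R)%:E <= ord (u n.+1 - u n))%E.
  elim: n => [|n IHn].
    by rewrite /u expn0 expn1 expr1 -natrX; apply/ord_eq_mod/fermat_little.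
  have -> : u n.+2 - u n.+1 = u n.+1 ^+ p - u n ^+ p by rewrite -!uX.
  by rewrite -natr1; apply: ord_subXp; rewrite ?ler1n.
have u_dist m n : (n <= m)%N -> ((n.+1%:R : R)%:E <= ord (u m - u n))%E.
  elim: m => [|m IHm].
    by rewrite leqn0 => /eqP ->; rewrite subrr ord_zero leey.
  rewrite leq_eqVlt => /orP[/eqP ->|nm]; first by rewrite subrr ord_zero leey.
  apply: (ord_dist_ge (y := u m)); last exact: IHm.
  by apply: le_trans (uS m); rewrite lee_fin ler_nat.
have uC : ord_cauchy ord u.
  move=> M; have [N MN] : exists N : nat, M <= N%:R.
    by exists (Num.bound `|M|); apply/(le_trans (ler_norm M))/ltW/archi_boundP.
  exists N => m n Nm Nn; apply: (ord_dist_ge (y := u N)).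
    by apply: le_trans (u_dist _ _ Nm); rewrite lee_fin (le_trans MN) ?ler_nat.
  by rewrite ordB; apply: le_trans (u_dist _ _ Nn); rewrite lee_fin (le_trans MN) ?ler_nat.
have [w uw] := Cp_complete CpP uC.
have near M : exists n, (M%:E <= ord (w - u n))%E.
  by have [N uwN] := uw M; exists N; rewrite ordB; apply: uwN.
have w_ge0 : (0 <= ord w)%E.
  by have [n wn] := near 0; rewrite -(subrK (u n) w); apply: ordD_ge.
exists w; split=> //.
- move=> M; have [n wn] := near M; exists (c ^ (p ^ n))%:R.
  by rewrite ratr_nat natrX.
- have [n wn] := near 1; apply: (ord_dist_ge wn).
  have := u_dist n 0%N (leq0n _); rewrite {2}/u expn0 expr1; apply: le_trans.
  by rewrite lee_fin.
- apply/eqP; rewrite -subr_eq0; apply/eqP/(Cp_ord_eq_infty CpP).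
  apply/eqyP => M _; have [N uwN] := uw M.
  apply: (ord_dist_ge (y := u N ^+ p)).
    by apply: ord_subX => //; rewrite ordB; apply: uwN.
  by rewrite -uX; apply: uwN.
Qed.

(** * Valuations of integer polynomials at primitive p-th roots of unity *)

Lemma ord_prod_const (I : Type) (r : seq I) (F : I -> K) (v : R) :
  (forall i, ord (F i) = v%:E) -> ord (\prod_(i <- r) F i) = (v *+ size r)%:E.
Proof.
move=> Fv; elim: r => [|i r IHr]; first by rewrite big_nil ord_one.
by rewrite big_cons mulrS; apply: ordM_fin.
Qed.


(** The p - 1 factors 1 - z^i, for 0 < i < p, have product p. They share one valuation: z - 1
    divides z^i - 1 and, z being a power of z^i, conversely. *)
Lemma ord_prim_root_sub1 z : p.-primitive_root z ->
  exists2 v : R, ord (z - 1) = v%:E & v *+ p.-1 = 1.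
Proof.
move=> z_prim; have p_gt1 := prime_gt1 p_prime; have p_gt0 := prime_gt0 p_prime.
have z_neq0 : z != 0 by rewrite (prim_root_eq0 z_prim) -lt0n.
have ordz n : (0 <= ord (z ^+ n))%E.
  apply: ordX_ge0; have [v zv] := ord_fin z_neq0.
  have := ordX_fin p zv; rewrite (prim_expr_order z_prim) ord_one => -[/esym/eqP].
  by rewrite mulrn_eq0 eqn0Ngt p_gt0 /= => /eqP v0; rewrite zv v0.
have le_ord i y : (0 <= ord y)%E -> (ord (y - 1) <= ord (y ^+ i - 1))%E.
  by move=> y0; rewrite -{2}(expr1n K i); apply: ord_subX; rewrite ?ord_one.
have z1 : z - 1 != 0.
  by rewrite subr_eq0 -[z]expr1 -(prim_order_dvd z_prim) dvdn1 gtn_eqF.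
have [v vz] := ord_fin z1; exists v => //.
have ordzi i : coprime p i -> ord (z ^+ i - 1) = v%:E.
  move=> cpi; apply/eqP; rewrite eq_le andbC -{1}vz le_ord /=; last exact: (ordz 1%N).
  have [u w uE _] := egcdnP p (coprime_p_gt0 cpi).
  have zE : (z ^+ i) ^+ u = z.
    rewrite -exprM mulnC uE exprD mulnC exprM (prim_expr_order z_prim) expr1n mul1r.
    by move: cpi; rewrite coprime_sym => /eqP ->.
  by rewrite -vz -{2}zE; apply: le_ord.
have prodE : \prod_(i < p.-1) (1 - z ^+ i.+1) = p%:R.
  (* Both sides equal X^p - 1; the factor X - 1 is cancelled before evaluating at 1. *)
  have : ('X - 1) * \prod_(i < p.-1) ('X - (z ^+ i.+1)%:P) =
         ('X - 1) * \sum_(i < p) 'X^i :> {poly K}.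
    rewrite -subrX1 -(factor_Xn_sub_1 z_prim) big_mkord.
    by rewrite -[in RHS](prednK p_gt0) big_ord_recl expr0 polyC1.
  have X1 : 'X - 1 != 0 :> {poly K} by rewrite -polyC1 polyXsubC_eq0.
  move/(mulfI X1)/(congr1 (horner^~ 1)); rewrite horner_prod horner_sum.
  under eq_bigr do rewrite hornerXsubC.
  under [RHS]eq_bigr do rewrite hornerXn expr1n.
  by rewrite sumr_const card_ord.
have := Cp_ord_p CpP; rewrite -prodE.
have -> : \prod_(i < p.-1) (1 - z ^+ i.+1) =
    \prod_(i <- index_enum 'I_p.-1) (1 - z ^+ i.+1) by [].
rewrite (@ord_prod_const _ _ _ v) => [[]|i]; last first.
  rewrite ordB ordzi // prime_coprime // gtnNdvd //.
  by have := ltn_ord i; lia.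
by rewrite /index_enum -enumT size_enum_ord.
Qed.

Lemma ord_horner_int (P : {poly int}) x (v : R) : (size P <= p.-1)%N ->
  ord x = v%:E -> v *+ p.-1 = 1 ->
  ord (map_poly intr P).[x] =
  \big[Order.min/+oo%E]_(i < size P) (ord (P`_i)%:~R + (v *+ i)%:E)%E.
Proof.
move=> sP xv v1.
have tE i : ord ((P`_i)%:~R * x ^+ i) = (ord (P`_i)%:~R + (v *+ i)%:E)%E.
  by rewrite (Cp_ordM CpP) (ordX_fin i xv).
rewrite (@horner_coef_wide _ (size P)); last exact: size_poly.
under eq_bigr => i _ do rewrite coef_map_id0 //.
rewrite ord_sum_distinct ?index_enum_uniq //; first by apply: eq_bigr => i _.
move=> i j _ _ i0; rewrite !tE => E.
have Pi0 : P`_i != 0 by apply: contraNneq i0 => ->; rewrite mul0r.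
have [Pj0|Pj0] := eqVneq P`_j 0.
  by move: E; rewrite Pj0 ord_zero ord_int.
move: E; rewrite !ord_int // -!EFinD => -[].
set a := logn _ _; set b := logn _ _ => E; apply: val_inj => /=.
(* As (p - 1) v = 1, this becomes a (p - 1) + i = b (p - 1) + j in the natural numbers; reducing
   modulo p - 1 gives i = j because both are smaller than p - 1. *)
have : (a%:R + v *+ i) *+ p.-1 = (b%:R + v *+ j) *+ p.-1 by rewrite E.
rewrite !mulrnDl (mulrnAC v i) (mulrnAC v j) v1 -!mulrnA -!natrD => /eqP.
rewrite eqr_nat => /eqP.
have := leq_trans (ltn_ord i) sP; have := leq_trans (ltn_ord j) sP.
move=> jp ip /(congr1 (modn^~ p.-1)).
by rewrite !modnMDl !modn_small.
Qed.

Lemma ord_conjugate (P : {poly int}) z z' :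
  p.-primitive_root z -> p.-primitive_root z' ->
  ord (map_poly intr P).[z] = ord (map_poly intr P).[z'].
Proof.
(* The p-th cyclotomic polynomial. It is monic, so division by it stays in Z[X]. *)
pose Phi : {poly int} := \poly_(i < p) 1.
have p_gt0 := prime_gt0 p_prime.
have sPhi : size Phi = p by rewrite size_poly_eq ?oner_neq0.
have mPhi : Phi \is monic.
  by rewrite monicE /lead_coef sPhi coef_poly prednK // leqnn.
(* The remainder, expanded around 1: P(y) = T(y - 1) for every primitive root y. *)
pose T := Pdiv.Ring.rmodp P Phi \Po ('X + 1%:P).
have sT : (size T <= p.-1)%N.
  rewrite size_comp_poly2; last exact: size_XaddC.
  by rewrite -ltnS prednK // -{1}sPhi Pdiv.Ring.ltn_rmodp -size_poly_eq0 sPhi -lt0n.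
have Phi0 (y : K) : p.-primitive_root y -> (map_poly intr Phi).[y] = 0.
  move=> y_prim; have y1 : y - 1 != 0.
    by rewrite subr_eq0 -[y]expr1 -(prim_order_dvd y_prim) dvdn1 gtn_eqF ?prime_gt1.
  apply: (mulfI y1); rewrite mulr0 (@horner_coef_wide _ p); last first.
    by rewrite -[X in (_ <= X)%N]sPhi size_poly.
  under eq_bigr => i _ do rewrite coef_map_id0 // coef_poly ltn_ord mul1r.
  by rewrite -subrX1 (prim_expr_order y_prim) subrr.
have PE (y : K) : p.-primitive_root y -> (map_poly intr P).[y] = (map_poly intr T).[y - 1].
  move=> y_prim; rewrite {1}(Pdiv.RingMonic.rdivp_eq mPhi P) rmorphD rmorphM /=.
  rewrite hornerD hornerM Phi0 // mulr0 add0r map_comp_poly horner_comp.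
  by rewrite rmorphD /= map_polyX map_polyC /= hornerD hornerX hornerC rmorph1 subrK.
move=> z_prim z'_prim; rewrite !PE //.
have [v zv v1] := ord_prim_root_sub1 z_prim.
have [w zw w1] := ord_prim_root_sub1 z'_prim.
rewrite (ord_horner_int sT zv v1) (ord_horner_int sT zw w1).
suff -> : v = w by [].
have p1 : p.-1%:R != 0 :> R.
  by apply/eqP=> p1; move: v1; rewrite -mulr_natr p1 mulr0 => /esym/eqP; rewrite oner_eq0.
by apply: (mulIf p1); rewrite !mulr_natr v1.
Qed.

(** * Conjugate elements of two copies of the cyclotomic field *)

(* For primitive p-th roots of unity z and z', this is the graph of the
   isomorphism Q(z) -> Q(z') sending z to z'. *)
Definition conjugates (z z' x y : K) : Prop :=
  exists (n : nat) (P : {poly int}), [/\ (0 < n)%N,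
    n%:R * x = (map_poly intr P).[z] & n%:R * y = (map_poly intr P).[z']].

Lemma conjugates_ord z z' x y : p.-primitive_root z -> p.-primitive_root z' ->
  conjugates z z' x y -> ord x = ord y.
Proof.
move=> z_prim z'_prim [n [P [n0 xP yP]]].
have := ord_conjugate P z_prim z'_prim; rewrite -xP -yP !(Cp_ordM CpP).
by rewrite ord_nat //; move: (ord x) (ord y) => [s||] [t||] //= [/addrI ->].
Qed.

Lemma conjugatesD z z' x y x' y' : conjugates z z' x y -> conjugates z z' x' y' ->
  conjugates z z' (x + x') (y + y').
Proof.
case=> n [P [n0 xP yP]] [m [Q [m0 xQ yQ]]].
exists (n * m)%N, (m%:R * P + n%:R * Q); rewrite muln_gt0 n0 m0.
by split=> //; rewrite natrM rmorphD !rmorphM !rmorph_nat /=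
  hornerD !hornerM -!polyC_natr !hornerC -?xP -?yP -?xQ -?yQ; ring.
Qed.

Lemma conjugatesM z z' x y x' y' : conjugates z z' x y -> conjugates z z' x' y' ->
  conjugates z z' (x * x') (y * y').
Proof.
case=> n [P [n0 xP yP]] [m [Q [m0 xQ yQ]]].
exists (n * m)%N, (P * Q); rewrite muln_gt0 n0 m0.
by split=> //; rewrite natrM rmorphM /= hornerM -?xP -?yP -?xQ -?yQ; ring.
Qed.

Lemma conjugates_nat z z' n : conjugates z z' n%:R n%:R.
Proof.
exists 1%N, n%:R; split=> //; by rewrite mul1r rmorph_nat -polyC_natr hornerC.
Qed.

Lemma conjugates_natV z z' n : conjugates z z' n%:R^-1 n%:R^-1.
Proof.
have [->|n0] := posnP n; first by rewrite invr0; apply: (conjugates_nat _ _ 0).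
exists n, 1; split=> //; by rewrite rmorph1 hornerC divff ?natr_neq0.
Qed.

Lemma conjugates_exp z z' n : conjugates z z' (z ^+ n) (z' ^+ n).
Proof.
exists 1%N, 'X^n; split=> //; by rewrite mul1r rmorphXn /= map_polyX hornerXn.
Qed.

Lemma conjugates_sum z z' (I : Type) (r : seq I) (P : pred I) (F G : I -> K) :
  (forall i, P i -> conjugates z z' (F i) (G i)) ->
  conjugates z z' (\sum_(i <- r | P i) F i) (\sum_(i <- r | P i) G i).
Proof.
move=> FG; apply: (big_ind2 (conjugates z z')) => //.
  exact: (conjugates_nat _ _ 0).
by move=> *; apply: conjugatesD.
Qed.

(** The coefficient is obtained from the u_k by sums, products and division by factorials, all of
    which preserve conjugacy. *)
Lemma conjugates_exp_coef z z' u w n :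
  (forall k, (0 < k)%N -> conjugates z z' (u k) (w k)) ->
  conjugates z z' (exp_coef u n) (exp_coef w n).
Proof.
move=> uw; rewrite /exp_coef !coef_sum.
set U := \sum_(1 <= k < _) _; set W := \sum_(1 <= k < _) w k *: _.
have UW i : conjugates z z' U`_i W`_i.
  rewrite !coef_sum big_nat_cond [X in conjugates _ _ _ X]big_nat_cond.
  apply: conjugates_sum => k /andP[/andP[k0 _] _].
  by rewrite !coefZ !coefXn; apply: conjugatesM (uw k k0) (conjugates_nat _ _ _).
have UWX j : forall i, conjugates z z' (U ^+ j)`_i (W ^+ j)`_i.
  elim: j => [|j IHj] i; first by rewrite !expr0 !coef1; apply: conjugates_nat.
  by rewrite !exprS !coefM; apply: conjugates_sum => l _; apply: conjugatesM.
apply: conjugates_sum => j _; rewrite !coefZ.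
exact: conjugatesM (conjugates_natV _ _ _) (UWX _ _).
Qed.

(** * Traces over Q_p *)

Lemma basis_coord_inj (E : set K) m n (e : 'I_n -> K) (A B : 'M[K]_(m, n)) :
  is_basis (Qp ord) E e ->
  (forall i j, Qp ord (A i j)) -> (forall i j, Qp ord (B i j)) ->
  A *m (\col_i e i) = B *m (\col_i e i) -> A = B.
Proof.
move=> [_ e_free _] QA QB AB; apply/matrixP => i j; apply/eqP; rewrite -subr_eq0.
apply/eqP; apply: (e_free (fun j => A i j - B i j)) => [l|].
  by apply: QpD => //; apply: QpN.
have /matrixP/(_ i ord0) := AB; rewrite !mxE => /eqP; rewrite -subr_eq0 -sumrB => /eqP.
by move=> H; rewrite -[RHS]H; apply: eq_bigr => l _; rewrite !mxE mulrBl.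
Qed.

Lemma basis_change (E : set K) n m (e : 'I_n -> K) (e' : 'I_m -> K) :
  is_basis (Qp ord) E e -> is_basis (Qp ord) E e' ->
  exists2 P : 'M[K]_(n, m), (forall i j, Qp ord (P i j)) &
    \col_i e i = P *m \col_j e' j.
Proof.
move=> [eE _ _] [_ _ e'_span].
have /choice[P PP] : forall i, exists c : 'I_m -> K,
    (forall j, Qp ord (c j)) /\ e i = \sum_j c j * e' j.
  by move=> i; have [c Qc ec] := e'_span _ (eE i); exists c.
exists (\matrix_(i, j) P i j) => [i j|]; first by rewrite mxE; apply: (PP i).1.
apply/matrixP => i j; rewrite !mxE (PP i).2.
by apply: eq_bigr => l _; rewrite !mxE.
Qed.

(** The change-of-basis matrices P and P' are mutually inverse and A P = P B, so cyclicity of the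
    trace concludes. The argument works with rectangular P, without first proving n = m. *)
Lemma trace_unique (E : set K) n m (e : 'I_n -> K) (e' : 'I_m -> K)
    (A : 'M[K]_n) (B : 'M[K]_m) x :
  is_basis (Qp ord) E e -> is_basis (Qp ord) E e' ->
  (forall i j, Qp ord (A i j)) -> (forall i j, Qp ord (B i j)) ->
  (forall i, x * e i = \sum_j A i j * e j) ->
  (forall i, x * e' i = \sum_j B i j * e' j) ->
  \tr A = \tr B.
Proof.
move=> be be' QA QB xA xB.
have [P QP eP] := basis_change be be'; have [P' QP' eP'] := basis_change be' be.
have {}xA : A *m (\col_i e i) = x *: (\col_i e i).
  by apply/matrixP => i j; rewrite !mxE xA; apply: eq_bigr => l _; rewrite mxE.
have {}xB : B *m (\col_i e' i) = x *: (\col_i e' i).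
  by apply/matrixP => i j; rewrite !mxE xB; apply: eq_bigr => l _; rewrite mxE.
have Qmul a b c (M : 'M[K]_(a, b)) (N : 'M[K]_(b, c)) :
    (forall i j, Qp ord (M i j)) -> (forall i j, Qp ord (N i j)) ->
    forall i j, Qp ord ((M *m N) i j).
  by move=> QM QN i j; rewrite mxE; apply: Qp_sum => l _; apply: QpM.
have Q1 a i j : Qp ord ((1%:M : 'M[K]_a) i j) by rewrite mxE; apply: Qp_nat.
have PP' : P *m P' = 1%:M.
  apply: (basis_coord_inj be); [exact: Qmul|exact: Q1|].
  by rewrite -mulmxA -eP' -eP mul1mx.
have P'P : P' *m P = 1%:M.
  apply: (basis_coord_inj be'); [exact: Qmul|exact: Q1|].
  by rewrite -mulmxA -eP -eP' mul1mx.
have AP : A *m P = P *m B.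
  apply: (basis_coord_inj be'); [exact: Qmul|exact: Qmul|].
  by rewrite -!mulmxA -eP xA xB -scalemxAr -eP.
by rewrite -[A]mulmx1 -PP' mulmxA AP -mulmxA mxtrace_mulC -mulmxA P'P mulmx1.
Qed.

Lemma field_trace_scale (E : set K) w w' x :
  Qp ord w -> Qp ord w' -> w' * w = 1 ->
  field_trace (Qp ord) E (w * x) = w * field_trace (Qp ord) E x.
Proof.
pose S x := [set t | exists n (e : 'I_n -> K) (A : 'M[K]_n),
    [/\ is_basis (Qp ord) E e,
        forall i j, Qp ord (A i j),
        forall i, x * e i = \sum_j A i j * e j
      & t = \tr A]].
have S_uniq y s t : S y s -> S y t -> s = t.
  move=> [n [e [A [be QA xA ->]]]] [m [e' [B [be' QB xB ->]]]].
  exact: (trace_unique be be' QA QB xA xB).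
have S_scale v y t : Qp ord v -> S y t -> S (v * y) (v * t).
  move=> Qv [n [e [A [be QA xA ->]]]]; exists n, e, (v *: A); split=> //.
  - by move=> i j; rewrite mxE; apply: QpM.
  - move=> i; rewrite -mulrA xA mulr_sumr; apply: eq_bigr => j _.
    by rewrite mxE mulrA.
  - by rewrite mxtraceZ.
move=> Qw Qw' w'w; rewrite /field_trace -!/(S _).
have [[t St]|noS] := pselect (exists t, S x t).
  apply: (S_uniq (w * x)); last exact/S_scale/(xgetPex 0 (ex_intro _ t St)).
  by apply: xgetPex; exists (w * t); apply: S_scale.
(* Both traces take the default 0: a trace for [w * x] would yield one for [x] on multiplying by
   [w'], which also lies in Q_p. *)
rewrite !xgetPN ?mulr0 // => t St; apply: noS; first by exists t.
by exists (w' * t); rewrite -[x]mul1r -w'w -mulrA; apply: S_scale.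
Qed.

(** * Scaling of Teichmuller lifts by an integer prime to p *)

Section TeichmullerScaling.
Variables (c c' : nat) (w : K).
Hypotheses (cc' : c' * c = 1 %[mod p]) (Qw : Qp ord w) (w_ge0 : (0 <= ord w)%E)
  (wc : (1 <= ord (w - c%:R))%E) (wp : w ^+ p = w).

Lemma teich_neq0 : w != 0.
Proof.
apply: contraTneq wc => ->; rewrite sub0r ordN ord_coprime; last first.
  rewrite prime_coprime //; apply/negP => /dvdnP[m mc].
  by move: cc'; rewrite mc mulnA modnMl modn_small ?prime_gt1.
by rewrite lee_fin ler10.
Qed.

(** As a power of [w], the inverse visibly lies in Q_p and is integral. *)
Lemma teich_invE : w^-1 = w ^+ p.-2.
Proof.
apply/(mulfI teich_neq0)/(mulfI teich_neq0); rewrite mulfV ?teich_neq0 // mulr1 -!exprS.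
by case: p p_prime wp => [|[|n]] //= _ ->.
Qed.

Lemma Qp_teich_inv : Qp ord w^-1.
Proof.
rewrite teich_invE; elim: p.-2 => [|n IHn]; first exact: (Qp_nat 1).
by rewrite exprS; apply: QpM.
Qed.

Lemma teich_inv_ge0 : (0 <= ord w^-1)%E.
Proof. by rewrite teich_invE; apply: ordX_ge0. Qed.

(** Since w is congruent to c modulo p, an exponent m is admissible for t exactly when c m is
    admissible for w t. Both sides therefore choose from the same set of values. *)
Lemma zeta_pow_teich zeta t : p.-primitive_root zeta ->
  zeta_pow ord zeta (w * t) = zeta_pow ord (zeta ^+ c) t.
Proof.
move=> zeta_prim; congr xget; apply/seteqP; split=> _ [m tm ->] /=.
  exists (c' * m)%N; last first.
    have E : (c * (c' * m) = m %[mod p])%N.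
      by rewrite mulnA (mulnC c) -modnMml cc' modnMml mul1n.
    by rewrite -exprM -[RHS](prim_expr_mod zeta_prim) E (prim_expr_mod zeta_prim).
  (* The factor multiplying m is w^-1 - c', rearranged to show that it is divisible by p: c' c is
     congruent to 1, and w to c. *)
  have -> : t - (c' * m)%:R =
      w^-1 * (w * t - m%:R) + m%:R * (w^-1 * ((1 - (c' * c)%:R) - c'%:R * (w - c%:R))).
    by rewrite !natrM; field; exact: teich_neq0.
  have [n0 i0] := (ord_nat_ge0, teich_inv_ge0).
  apply: ordD_ge; first exact: ordM_ge.
  apply: ordM_ge => //; apply: ordM_ge => //; apply: ordD_ge.
    exact/(ord_eq_mod (m := 1))/esym.
  by rewrite ordN; apply: ordM_ge.
exists (c * m)%N; last by rewrite exprM.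
have -> : w * t - (c * m)%:R = w * (t - m%:R) + m%:R * (w - c%:R).
  by rewrite natrM; ring.
by apply: ordD_ge; apply: ordM_ge => //; apply: ord_nat_ge0.
Qed.

Variables (k : fieldType) (red : K -> k) (redP : is_reduction ord red).

Lemma red_nat n : red n%:R = n%:R.
Proof.
elim: n => [|n IHn]; first by apply/(red_eq0 redP); rewrite ord_zero ?leey ?ltey.
by rewrite !mulrS (redD redP) ?ord_one ?ord_nat_ge0 // (red1 redP) IHn.
Qed.

Lemma pchar_red : p%:R = 0 :> k.
Proof.
by rewrite -red_nat; apply/(red_eq0 redP); rewrite (Cp_ord_p CpP) ?lte01 ?lee01.
Qed.

Lemma red_teich : red w = c%:R.
Proof.
rewrite -red_nat -(subrK c%:R w) (redD redP) ?ord_nat_ge0 //; last first.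
  by apply: le_trans wc; rewrite lee01.
suff -> : red (w - c%:R) = 0 by rewrite add0r.
apply/(red_eq0 redP); first by apply: le_trans wc; rewrite lee01.
by apply: lt_le_trans wc; rewrite lte01.
Qed.

Lemma redX x n : (0 <= ord x)%E -> red (x ^+ n) = red x ^+ n.
Proof.
move=> x0; elim: n => [|n IHn]; first by rewrite !expr0 (red1 redP).
by rewrite !exprS (redM redP) ?ordX_ge0 // IHn.
Qed.

(* If s <> t, cancelling s - t in s ^ q - t ^ q = s - t gives
   1 = \sum_i s ^ (q - 1 - i) t ^ i, whose reduction is q u ^ (q - 1) = 0. *)
Lemma teich_uniq n s t : (0 < n)%N -> (0 <= ord s)%E -> (0 <= ord t)%E ->
  red s = red t -> s ^+ (p ^ n) = s -> t ^+ (p ^ n) = t -> s = t.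
Proof.
move=> n0 s0 t0 rst sq tq; apply/eqP; rewrite -subr_eq0; apply/negPn/negP => st.
have := subrXX s t (p ^ n); rewrite sq tq -{1}[s - t]mulr1 => /(mulfI st).
move/(congr1 red); rewrite (red1 redP).
have red_sum (I : Type) (r : seq I) (F : I -> K) : (forall i, 0 <= ord (F i))%E ->
    red (\sum_(i <- r) F i) = \sum_(i <- r) red (F i).
  move=> F0; elim: r => [|i r IHr]; first by rewrite !big_nil (red_nat 0).
  by rewrite !big_cons (redD redP) ?IHr //; apply: ord_sum_ge.
rewrite red_sum => [|i]; last by apply: ordM_ge; apply: ordX_ge0.
rewrite (eq_bigr (fun=> red t ^+ (p ^ n).-1)) => [|i _]; last first.
  rewrite (redM redP) ?ordX_ge0 // !redX // rst -exprD subnK //.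
  by have := ltn_ord i; lia.
rewrite sumr_const card_ord -mulr_natr natrX pchar_red expr0n gtn_eqF // mulr0.
by move/eqP; rewrite oner_eq0.
Qed.

Variables (Q : nat -> set K) (n : nat) (n_gt0 : (0 < n)%N).
Hypothesis QP : is_unramified_ext ord n (Q n).

(** Multiplication by w carries lifts of u to lifts of c u, and w^-1 carries them back. Thus
    uniqueness settles the case where a lift exists; otherwise both sides are the default 0. *)
Lemma teichmuller_scale u :
  teichmuller p ord red Q n (c%:R * u) = w * teichmuller p ord red Q n u.
Proof.
pose S u := [set t | [/\ Q n t, (0 <= ord t)%E, red t = u & t ^+ (p ^ n) = t]].
have S_uniq v s t : S v s -> S v t -> s = t.
  by move=> [_ s0 <- sq] [_ t0 ts tq]; apply: (teich_uniq n_gt0).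
have wq : w ^+ (p ^ n) = w.
  by elim: (n) => [|i IHi]; rewrite ?expr1 // expnSr exprM IHi wp.
have [[Q1 QB QV] QpQ _ _] := QP.
have QM x y : Q n x -> Q n y -> Q n (x * y).
  move=> Qx Qy; have [y0|y0] := eqVneq y 0; first by rewrite y0 mulr0 -y0.
  rewrite -[y]invrK; apply/set_mem/(QV _ _); first exact/mem_set.
  by rewrite -[y^-1]mul1r; apply: QV => //; apply/mem_set.
have S_scale t v : S v t -> S (c%:R * v) (w * t).
  move=> [Qt t0 <- tq]; split.
  - by apply: QM => //; apply: QpQ.
  - exact: ordM_ge.
  - by rewrite (redM redP) // red_teich.
  - by rewrite exprMn wq tq.
have S_scaleV t v : S (c%:R * v) t -> S v (w^-1 * t).
  move=> [Qt t0 tv tq]; split.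
  - by apply: QM => //; apply: QpQ; apply: Qp_teich_inv.
  - by apply: ordM_ge => //; apply: teich_inv_ge0.
  - rewrite (redM redP) ?teich_inv_ge0 // tv mulrA -red_teich -(redM redP) ?teich_inv_ge0 //.
    by rewrite mulVf ?teich_neq0 // (red1 redP) mul1r.
  - by rewrite exprMn exprVn wq tq.
rewrite /teichmuller -!/(S _).
have [[t St]|noS] := pselect (exists t, S u t).
  apply: (S_uniq (c%:R * u)); last exact/S_scale/(xgetPex 0 (ex_intro _ t St)).
  by apply: xgetPex; exists (w * t); apply: S_scale.
rewrite !xgetPN ?mulr0 // => t St; apply: noS; first by exists t.
by exists (w^-1 * t); apply: S_scaleV.
Qed.

Lemma teichmuller_poly_scale g x : c%:R != 0 :> k ->
  (teichmuller_poly p ord red Q n (c%:R *: g)).[x] =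
  w * (teichmuller_poly p ord red Q n g).[x].
Proof.
move=> c0; rewrite -hornerZ; congr horner; apply/polyP => i.
rewrite coefZ !coef_poly size_scale //; case: ifP => _; last by rewrite mulr0.
by rewrite coefZ teichmuller_scale.
Qed.

End TeichmullerScaling.

(** * Dependence of the exponential sums on the root of unity *)

(** The exponent is chosen from t alone, so one choice serves all primitive roots. Its default 0
    matches the default value 1 of [zeta_pow]. *)
Definition zeta_exponent (t : K) : nat :=
  xget 0%N [set m : nat | (1 <= ord (t - m%:R))%E].

Lemma zeta_powE zeta t : p.-primitive_root zeta ->
  zeta_pow ord zeta t = zeta ^+ zeta_exponent t.
Proof.
move=> zeta_prim; rewrite /zeta_pow /zeta_exponent.
have [[m tm]|no] := pselect (exists m : nat, (1 <= ord (t - m%:R))%E); last first.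
  rewrite !xgetPN ?expr0 // => [m tm|z [m tm _]]; apply: no; by exists m.
set M := xget 0%N _; have tM : (1 <= ord (t - M%:R))%E.
  by apply: (@xgetPex _ 0%N [set m : nat | (1 <= ord (t - m%:R))%E]); exists m.
set S := [set _ | _]; have [i ti ->] : S (xget 1 S).
  by apply: xgetPex; exists (zeta ^+ m), m.
have : (1 <= ord (i%:R - M%:R))%E by apply: ord_dist_ge tM; rewrite ordB.
move: M {tM} => M; wlog iM : i M {ti} / (M <= i)%N => [H iM|].
  have [Mi|/ltnW Mi] := leqP M i; first exact: H.
  by apply/esym/H; rewrite // ordB.
rewrite -natrB // => d1; rewrite -(subnK iM) exprD.
(* Two admissible exponents differ by a multiple of p, since an integer prime to p has valuation
   0. *)
suff /eqP -> : zeta ^+ (i - M) == 1 by rewrite mul1r.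
rewrite -(prim_order_dvd zeta_prim); apply: contraTT d1.
by rewrite -prime_coprime // => /ord_coprime ->; rewrite lee_fin ler10.
Qed.

Lemma exp_sum_conjugates (k : fieldType) (red : K -> k) (Q : nat -> set K)
    z z' a g m : p.-primitive_root z -> p.-primitive_root z' ->
  conjugates z z' (exp_sum p ord red Q z a g m) (exp_sum p ord red Q z' a g m).
Proof.
move=> z_prim z'_prim; rewrite /exp_sum.
set A := [set _ | _]; pose tr u := field_trace (Qp ord) (Q (a * m)%N)
  (teichmuller_poly p ord red Q a g).[teichmuller p ord red Q (a * m) u].
have E y : p.-primitive_root y -> \sum_(u \in A) zeta_pow ord y (tr u) =
    \sum_(u <- finmap.enum_fset (fset_set A)) y ^+ zeta_exponent (tr u).
  move=> y_prim.
  have -> : (fun u => zeta_pow ord y (tr u)) = (fun u => y ^+ zeta_exponent (tr u)).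
    by apply: funext => u; apply: zeta_powE.
  (* The sum runs over the support of its summand within A. Powers of y never vanish, so both roots
     give the same list of indices. *)
  have AE : A `&` (fun u => y ^+ zeta_exponent (tr u)) @^-1` [set~ 0] = A.
    apply/seteqP; split=> u /=; [by case|split=> //].
    by apply/eqP; rewrite expf_neq0 // (prim_root_eq0 y_prim) -lt0n prime_gt0.
  rewrite /finite_support [locked_with _ _]unlock AE.
  by apply: eq_bigr => u _; apply: zeta_powE.
rewrite [X in conjugates _ _ X _](E z z_prim) [X in conjugates _ _ _ X](E z' z'_prim).
by apply: conjugates_sum => u _; apply: conjugates_exp.
Qed.

Lemma Lstar_coef_scale_nat (k : fieldType) (red : K -> k) (Q : nat -> set K)
    zeta a c g n : is_reduction ord red -> (0 < a)%N ->
  is_unramified_ext ord a (Q a) -> p.-primitive_root zeta -> coprime c p ->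
  c%:R != 0 :> k ->
  Lstar_coef p ord red Q zeta a (c%:R *: g) n =
  Lstar_coef p ord red Q (zeta ^+ c) a g n.
Proof.
move=> redP a_gt0 QP zeta_prim cp c0.
have [w [Qw w_ge0 wc wp]] := Qp_teichmuller c.
have [c' cc'] : exists c', c' * c = 1 %[mod p].
  have c_gt0 : (0 < c)%N by apply: coprime_p_gt0; rewrite coprime_sym.
  have [u v uE _] := egcdnP p c_gt0; exists u; rewrite uE.
  by move/eqP: cp => ->; rewrite modnMDl.
rewrite /Lstar_coef; congr exp_coef; apply: funext => m; congr (_ / _).
rewrite /exp_sum; apply: eq_fsbigr => u _.
rewrite (teichmuller_poly_scale cc' Qw w_ge0 wc wp redP a_gt0 QP) //.
rewrite (field_trace_scale _ _ Qw (Qp_teich_inv cc' Qw wc wp)).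
  exact: (zeta_pow_teich cc').
by rewrite mulVf // (teich_neq0 cc' wc).
Qed.
End Valuation.

(** * Fixed points of Frobenius and the comparison of Newton polygons *)

(** Otherwise x and the images of 0, ..., p - 1 would be p + 1 distinct roots of X^p - X. *)
Lemma frobenius_fixed_nat (F : idomainType) p (x : F) :
  p \in [pchar F] -> x ^+ p = x -> exists c : nat, x = c%:R.
Proof.
move=> pcharF xp; have p_gt1 := prime_gt1 (pcharf_prime pcharF).
pose rs : seq F := [seq i%:R | i <- iota 0 p].
have [/mapP[c _ ->]|x_rs] := boolP (x \in rs); first by exists c.
have sP : size ('X^p - 'X : {poly F}) = p.+1.
  by rewrite size_polyDl ?size_polyXn // size_polyN size_polyX.
have P0 : 'X^p - 'X != 0 :> {poly F} by rewrite -size_poly_eq0 sP.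
have rootP y : y ^+ p = y -> root ('X^p - 'X) y.
  by move=> yp; rewrite rootE hornerD hornerN hornerXn hornerX yp subrr.
have rs_roots : all (root ('X^p - 'X)) (x :: rs).
  rewrite /= rootP //; apply/allP => _ /mapP[i _ ->]; apply: rootP.
  by rewrite -(pFrobenius_autE pcharF) pFrobenius_aut_nat.
have rs_uniq : uniq (x :: rs).
  rewrite /= x_rs map_inj_in_uniq ?iota_uniq // => i j.
  rewrite !mem_iota !add0n /= => ip jp /eqP; apply: contraTeq.
  wlog ij : i j ip jp / (i < j)%N => [H|_].
    by rewrite neq_ltn => /orP[ij|ij]; [|rewrite eq_sym]; apply: H; rewrite ?ltn_eqF.
  rewrite eq_sym -subr_eq0 -natrB 1?ltnW // -(dvdn_pcharf pcharF) gtnNdvd ?subn_gt0 //.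
  exact: leq_ltn_trans (leq_subr _ _) jp.
by have := max_poly_roots P0 rs_roots rs_uniq; rewrite sP /= size_map size_iota ltnn.
Qed.

Theorem theorem1p4
  (R : realType) (p : nat) (p_prime : prime p)
  (Cp : closedFieldType) (ord : Cp -> \bar R) (CpP : is_Cp ord p)
  (Fpbar : closedFieldType) (iota : {rmorphism 'F_p -> Fpbar})
  (FpbarP : integralRange iota)
  (red : Cp -> Fpbar) (redP : is_reduction ord red)
  (Q : nat -> set Cp)
  (QP : forall n : nat, (0 < n)%N -> is_unramified_ext ord n (Q n))
  (zeta : Cp) (zetaP : p.-primitive_root zeta)
  (f : {poly Fpbar}) (d : nat) (deg_f : size f = d.+1) (d_p : coprime d p)
  (lambda mu : Fpbar) (lambda_neq0 : lambda != 0) (mu_neq0 : mu != 0)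
  (lambda_mu : lambda ^+ p.-1 = mu ^+ p.-1)
  (a : nat) (a_gt0 : (0 < a)%N)
  (f_Fq : f \is a polyOver (Fq Fpbar p a))
  (lambda_Fq : lambda \in Fq Fpbar p a) (mu_Fq : mu \in Fq Fpbar p a) :
  newton_polygon p ord red Q zeta a (lambda *: f) =
  newton_polygon p ord red Q zeta a (mu *: f).
Proof.
have [c c_gt0 cE] : exists2 c, coprime c p & lambda = c%:R * mu.
  have pcharF : p \in [pchar Fpbar] by apply/(rmorph_pchar iota)/pchar_Fp.
  have [c cE] : exists c : nat, lambda / mu = c%:R.
    apply: (frobenius_fixed_nat pcharF).
    have -> : p = p.-1.+1 by rewrite prednK ?prime_gt0.
    by rewrite exprS expr_div_n lambda_mu divff ?mulr1 // expf_neq0.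
  have lE : lambda = c%:R * mu by rewrite -cE divfK.
  exists c => //; rewrite coprime_sym prime_coprime // (dvdn_pcharf pcharF).
  by apply: contraNneq lambda_neq0 => c0; rewrite lE c0 mul0r.
have c0 : c%:R != 0 :> Fpbar.
  by apply: contraNneq lambda_neq0 => c0; rewrite cE c0 mul0r.
rewrite cE -scalerA; set g := mu *: f.
(* The polygon depends only on these valuations and on the degree, which scaling by a nonzero
   constant preserves. *)
suff ordE n : ord (Lstar_coef p ord red Q zeta a (c%:R *: g) n) =
              ord (Lstar_coef p ord red Q zeta a g n).
  rewrite /newton_polygon (size_scale g c0).
  apply: (congr1 (@lower_convex_hull R)); rewrite predeqE => x.
  by split=> -[n]; [rewrite ordE|rewrite -ordE] => H; exists n; exact: H.
have zetacP : p.-primitive_root (zeta ^+ c) by rewrite prim_root_exp_coprime.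
rewrite (Lstar_coef_scale_nat p_prime CpP _ _ redP a_gt0 (QP a a_gt0)) //.
(* The two sides now differ only in the root, [zeta ^+ c] against [zeta]; both are primitive, so
   conjugacy of the coefficients suffices. *)
apply: (conjugates_ord p_prime CpP zetacP zetaP).
apply: (conjugates_exp_coef p_prime CpP) => m _.
apply: (conjugatesM _ (conjugates_natV p_prime CpP _ _ m)).
exact: exp_sum_conjugates.
Qed.
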